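(* Fix an integer $k \geq 4$. For a finite projective plane $\Pi$ of order $n$ with Levi graph $\Gamma_{\Pi}$, $$c_{2k}(\Gamma_{\Pi}) = \frac{1}{2k}n^{2k} + O(n^{2k-2}) \quad \text{as } n \to \infty.$$ Here the implied constant in $O(n^{2k-2})$ depends only on $k$, not on the particular plane $\Pi$.
   Context: For a finite projective plane $\Pi$ of order $n$, the Levi graph (point-line incidence graph) $\Gamma_{\Pi}$ is the bipartite graph whose two vertex classes are the set of points and the set of lines of $\Pi$, a point $P$ being adjacent to a line $\ell$ iff $P$ lies on $\ell$. For a graph $G$, $c_{2k}(G)$ denotes the number of cycles of length $2k$ in $G$ (as subgraphs). *)

(* Defs.v *)
From mathcomp Require Import all_boot all_order all_algebra.
Set Implicit Arguments.
Unset Strict Implicit.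
Unset Printing Implicit Defensive.

Record projective_plane := ProjectivePlane {
  point : finType;
  line : finType;
  incident : point -> line -> bool;
  join_axiom : forall p q : point, p != q ->
    exists! l : line, incident p l && incident q l;
  meet_axiom : forall l m : line, l != m ->
    exists! p : point, incident p l && incident p m;
  (* four points, no three of them collinear *)
  quadrangle_axiom : exists Q : {set point},
    #|Q| = 4 /\ forall l : line, #|[set p in Q | incident p l]| <= 2
}.

Definition has_order (Pi : projective_plane) (n : nat) : Prop :=
  forall l : line Pi, #|[set p : point Pi | incident p l]| = n.+1.

Definition levi_vertex (Pi : projective_plane) : finType :=
  (point Pi + line Pi)%type.

Definition levi (Pi : projective_plane) : rel (levi_vertex Pi) :=
  fun u v =>
    match u, v with
    | inl p, inr l | inr l, inl p => incident p l
    | _, _ => false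
    end.

Lemma levi_sym (Pi : projective_plane) : symmetric (@levi Pi).
Proof. by case=> [p|l] [q|m]. Qed.

Lemma levi_irrefl (Pi : projective_plane) : irreflexive (@levi Pi).
Proof. by case. Qed.

(* A subgraph is a pair (vertex set, edge set), an edge being an unordered pair
   of vertices. *)
Definition subgraph_of_seq (V : finType) (s : seq V) :
    {set V} * {set {set V}} :=
  ([set x in s], [set [set x; next s x] | x in s]).

(* Each subgraph is counted once, whatever the starting vertex and direction of
   the closed walk t tracing it. The condition 2 < m excludes the degenerate
   closed walks of length at most 2, which are not cycles of a simple graph. *)
Definition cycle_subgraphs (V : finType) (e : rel V) (m : nat) :
    {set {set V} * {set {set V}}} :=
  [set H | (2 < m) &&
    [exists t : m.-tuple V, ucycleb e t && (H == subgraph_of_seq t)]].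

Definition num_cycles (V : finType) (e : rel V) (m : nat) : nat :=
  #|cycle_subgraphs e m|.

(* Main.v *)
Require Import Defs.
From mathcomp Require Import all_boot all_order all_algebra.
From mathcomp Require Import zify ring lra.
Set Implicit Arguments.
Unset Strict Implicit.
Unset Printing Implicit Defensive.
Import Order.TTheory GRing.Theory Num.Theory.

(* A cycle of length 2k in the Levi graph has 2k parametrisations starting at a
   point, so 2k c_2k is the number of k-tuples of distinct points whose k
   cyclically consecutive joining lines are distinct. Let N = n^2 + n + 1 be the
   number of points. All but O(n^(2k-2)) of the N^k tuples are nondegenerate:
   their points are distinct and at most one triple of indices is collinear.
   A nondegenerate tuple fails to be a polygon iff exactly one of its k
   consecutive triples is collinear (k >= 4 makes these triples distinct), and
   each consecutive triple is collinear for N^(k-2) (N-1) (n+1) tuples. Hence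
   2k c_2k = N^k - k N^(k-2) (N-1) (n+1) + O(n^(2k-2)), where the terms of order
   n^(2k-1) cancel. *)

(** * Cycles as injective closed walks on Z/m *)

(* The index type ['I_m.+3] carries the ring structure of Z/(m+3), so [i + 1] is
   the cyclic successor; likewise [k = k'.+4] for polygons below. *)
Section CyclicWalks.
Variables (V : finType) (e : rel V) (m : nat).
Hypothesis e_sym : symmetric e.
Local Notation I := 'I_m.+3.
Local Open Scope ring_scope.
Implicit Types (f g : {ffun I -> V}) (i j a : I).

Definition cyclic_walks : {set {ffun I -> V}} :=
  [set f : {ffun I -> V} | injectiveb f && [forall i, e (f i) (f (i + 1))]].

Lemma cyclic_walksP f :
  reflect (injective f /\ forall i, e (f i) (f (i + 1))) (f \in cyclic_walks).
Proof. by rewrite inE; apply: (iffP andP) => -[] /injectiveP ? /forallP. Qed.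

(** Mirrors [subgraph_of_seq] with [next] replaced by the successor in Z/(m+3), so that
    reparametrisation becomes ring arithmetic on indices. *)
Definition walk_subgraph f : {set V} * {set {set V}} :=
  ([set f i | i : I], [set [set f i; f (i + 1)] | i : I]).

Definition walk_of_tuple (t : m.+3.-tuple V) : {ffun I -> V} :=
  [ffun i => tnth t i].

Lemma ordS_lt i : (i.+1 < m.+3)%N -> (i + 1 : I) = i.+1 :> nat.
Proof. by move=> h /=; rewrite modnDmr addn1 modn_small. Qed.

Lemma ordS_last i : (i.+1 < m.+3)%N = false -> i + 1 = 0.
Proof.
move=> h; have -> : i = ord_max by apply/val_inj => /=; have := ltn_ord i; lia.
by apply/val_inj => /=; rewrite [(1 %% _)%N]modn_small // addn1 modnn.
Qed.

Lemma next_tnth (t : m.+3.-tuple V) i :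
  uniq t -> next t (tnth t i) = tnth t (i + 1).
Proof.
move=> Ut; rewrite next_nth mem_tnth.
have -> : index (tnth t i) t = i.
  by rewrite (tnth_nth (tnth t i)) index_uniq ?size_tuple.
case: t Ut => -[|y s] //= st Ut; rewrite (tnth_nth y).
case h : (i.+1 < m.+3)%N; first by rewrite (ordS_lt h).
rewrite (ordS_last h) /=.
(* At the last index [nth] runs past the tail [s] and returns its default [y], the head of the
   tuple: this is the wrap-around. *)
by rewrite nth_default // ; move: st => /= /eqP[]; have := ltn_ord i; lia.
Qed.

Lemma cycle_tnth (t : m.+3.-tuple V) :
  cycle e t = [forall i, e (tnth t i) (tnth t (i + 1))].
Proof.
case: t => -[|y s] //= st.
have ss : size s = m.+2 by move: st => /= /eqP[].
(* [cycle] is a [path] from [y] along [rcons s y]. Its i-th step goes from entry i of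
   [y :: rcons s y] to entry i of [rcons s y], that is, between cyclically consecutive entries. *)
have nextE i : nth y (rcons s y) i = tnth (@Tuple m.+3 V (y :: s) st) (i + 1).
  rewrite (tnth_nth y) nth_rcons ss; case c : (i.+1 < m.+3)%N.
    by rewrite (ordS_lt c); move: (c); rewrite ltnS => ->.
  by rewrite (ordS_last c); move: (c); rewrite ltnS => ->; case: eqP.
have thisE i : nth y (y :: rcons s y) i = tnth (@Tuple m.+3 V (y :: s) st) i.
  by rewrite (tnth_nth y) -rcons_cons nth_rcons /= ss ltn_ord.
apply/(pathP y)/forallP => [h i|h i].
  by rewrite -thisE -nextE; apply: h; rewrite size_rcons ss.
rewrite size_rcons ss => hi.
by have := h (Ordinal hi); rewrite -thisE -nextE.
Qed.

Lemma ucycle_walk (t : m.+3.-tuple V) :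
  ucycleb e t = (walk_of_tuple t \in cyclic_walks).
Proof.
rewrite inE /ucycleb cycle_tnth andbC; congr (_ && _).
  apply/tuple_uniqP/injectiveP => h i j; last by move=> E; apply: h; rewrite !ffunE.
  by rewrite !ffunE => /h.
by apply: eq_forallb => i; rewrite !ffunE.
Qed.

Lemma subgraph_of_tuple (t : m.+3.-tuple V) :
  uniq t -> subgraph_of_seq t = walk_subgraph (walk_of_tuple t).
Proof.
move=> Ut; congr pair.
  apply/setP=> x; rewrite inE; apply/tnthP/imsetP => -[i].
    by move=> ->; exists i => //; rewrite ffunE.
  by rewrite ffunE => _ ->; exists i.
apply/setP=> x; apply/imsetP/imsetP => -[i].
  by move=> /tnthP[j ->] ->; exists j => //; rewrite !ffunE next_tnth.
by move=> _ ->; exists (tnth t i); rewrite ?mem_tnth // !ffunE next_tnth.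
Qed.

Lemma cycle_subgraphs_walks :
  cycle_subgraphs e m.+3 = [set walk_subgraph f | f in cyclic_walks].
Proof.
apply/setP=> H; rewrite inE /=; apply/existsP/imsetP.
  move=> [t /andP[ct /eqP->]]; exists (walk_of_tuple t).
    by rewrite -ucycle_walk.
  by rewrite subgraph_of_tuple //; case/andP: ct.
move=> [f fF ->]; exists [tuple f i | i < m.+3].
have E : walk_of_tuple [tuple f i | i < m.+3] = f.
  by apply/ffunP => i; rewrite ffunE tnth_mktuple.
have U : ucycleb e [tuple f i | i < m.+3] by rewrite ucycle_walk E.
by rewrite U subgraph_of_tuple ?E ?eqxx //; case/andP: U.
Qed.

(** The action of the dihedral group of order 2(m+3): [u.1] is the new starting index, [u.2] the
    direction. *)
Definition dihedral f (u : I * bool) : {ffun I -> V} :=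
  [ffun i => f (if u.2 then u.1 + i else u.1 - i)].

Lemma Zp_small_neq0 (d : nat) : (0 < d < m.+3)%N -> (d%:R : I) != 0.
Proof.
move=> /andP[d0 dm]; rewrite -val_eqE /= -[X in X != _]/(nat_of_ord (d%:R : I)).
have -> : (d%:R : I) = d :> nat by rewrite Zp_nat /= modn_small.
by rewrite -lt0n.
Qed.

(** Evaluation at 0 recovers the starting index [a], and evaluation at 1 the direction: a + 1 and a
    - 1 differ since 2 is nonzero modulo m + 3. *)
Lemma dihedral_inj f : injective f -> injective (dihedral f).
Proof.
move=> fI [a s] [b r] E.
have Ei i : dihedral f (a, s) i = dihedral f (b, r) i by rewrite E.
move: (Ei 0) (Ei 1); rewrite !ffunE /=.
have d0 c (z : bool) : (if z then c + 0 else c - 0) = c :> I by case: z; ring.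
rewrite !d0 => /fI <- /fI H; congr pair.
have n2 := @Zp_small_neq0 2 isT.
move: H; case: s r {E Ei} => [] [] // H; case/negP: n2; apply/eqP.
  by transitivity ((a + 1) - (a - 1)); [ring|rewrite H; ring].
by transitivity ((a + 1) - (a - 1)); [ring|rewrite H; ring].
Qed.

Lemma dihedral_walk f u : f \in cyclic_walks -> dihedral f u \in cyclic_walks.
Proof.
move=> /cyclic_walksP[fI fe]; apply/cyclic_walksP; split=> [i j|i].
  by rewrite !ffunE => /fI; case: u.2 => [/addrI|/addrI/oppr_inj].
rewrite !ffunE; case: u.2; first by rewrite addrA.
by rewrite e_sym; have := fe (u.1 - (i + 1)); congr e; congr (f _); ring.
Qed.

Lemma dihedral_subgraph f u : walk_subgraph (dihedral f u) = walk_subgraph f.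
Proof.
congr pair; apply/setP => x; apply/imsetP/imsetP => -[i _ ->]; rewrite ?ffunE.
- by eexists.
- exists (if u.2 then i - u.1 else u.1 - i) => //; rewrite ffunE.
  by congr (f _); case: u.2; ring.
- case: u.2; first by exists (u.1 + i) => //; rewrite addrA.
  exists (u.1 - (i + 1)) => //; rewrite setUC.
  by congr [set _; f _]; ring.
- exists (if u.2 then i - u.1 else u.1 - (i + 1)) => //; rewrite !ffunE.
  case: u.2; first by congr [set f _; f _]; ring.
  by rewrite setUC; congr [set f _; f _]; ring.
Qed.

(* A cyclic walk visits neighbouring positions of any other walk tracing the
   same subgraph, and by injectivity it can never turn around. *)
Lemma same_subgraph_dihedral f g :
  f \in cyclic_walks -> g \in cyclic_walks ->
  walk_subgraph g = walk_subgraph f -> exists u, g = dihedral f u.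
Proof.
move=> /cyclic_walksP[fI _] /cyclic_walksP[gI _] [EV EE].
have /fin_all_exists[s gE] i : exists j, g i = f j.
  by have /imsetP[j _ ->] : g i \in [set f i | i : I];
    [rewrite -EV imset_f|exists j].
have sI : injective s by move=> i j E; apply: gI; rewrite !gE E.
have sS i : s (i + 1) = s i + 1 \/ s (i + 1) = s i - 1.
  have /imsetP[j _ E] : [set g i; g (i + 1)] \in [set [set f i; f (i + 1)] | i : I].
    by rewrite -EE; apply/imsetP; exists i.
  have ne : s i != s (i + 1).
    apply/eqP => /sI /eqP; rewrite -subr_eq0.
    have -> : i - (i + 1) = - 1 by ring.
    by rewrite oppr_eq0; apply/negP/(@Zp_small_neq0 1).
  have: g i \in [set f j; f (j + 1)] by rewrite -E set21.
  have: g (i + 1) \in [set f j; f (j + 1)] by rewrite -E set22.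
  rewrite !inE !gE !(inj_eq fI).
  move=> /orP[] /eqP E1 /orP[] /eqP E2; move: ne; rewrite E1 E2 ?eqxx // => _.
    by right; ring.
  by left.
have step (b : bool) i : s (i + 1) = s i + (-1) ^+ b ->
                s (i + 1 + 1) = s (i + 1) + (-1) ^+ b.
  move=> E.
  have ne : s (i + 1 + 1) != s i.
    apply/eqP => /sI /eqP; rewrite -subr_eq0.
    have -> : i + 1 + 1 - i = 2%:R by ring.
    by apply/negP/(@Zp_small_neq0 2).
  by case: b E => [|]; rewrite ?expr1 ?expr0 => E; case: (sS (i + 1)) => E' //;
    case/eqP: ne; rewrite E' E; ring.
have [b s1] : exists b : bool, s (0 + 1) = s 0 + (-1) ^+ b.
  by case: (sS 0) => E; [exists false|exists true]; rewrite E.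
have st (d : nat) : s (d%:R + 1) = s d%:R + (-1) ^+ b.
  elim: d => [|d IH]; first exact: s1.
  by rewrite -natr1; apply: step.
have sd (d : nat) : s d%:R = s 0 + (-1) ^+ b * d%:R.
  elim: d => [|d IH]; first by rewrite mulr0 addr0.
  by rewrite -natr1 st IH; ring.
(* [b] marks the sign -1, whereas the boolean of a dihedral index is true for rotations; hence the
   negation. *)
exists (s 0, ~~ b); apply/ffunP => i; rewrite ffunE gE /=; congr (f _).
have := sd i; rewrite (natr_Zp (i : 'Z_m.+3)) => ->.
by case: b {step s1 st sd} => /=; ring.
Qed.

(** Each fibre of [walk_subgraph] over [cyclic_walks] is a single dihedral orbit, of size 2(m+3). *)
Lemma card_cyclic_walks : #|cyclic_walks| = (num_cycles e m.+3 * (2 * m.+3))%N.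
Proof.
rewrite /num_cycles cycle_subgraphs_walks -sum1_card.
rewrite (partition_big_imset walk_subgraph) /= -sum_nat_const.
apply: eq_bigr => _ /imsetP[f fF ->]; rewrite sum1_card.
have fI : injective f by case/cyclic_walksP: fF.
have <- : #|[set dihedral f u | u : I * bool]| = (2 * m.+3)%N.
  rewrite (card_imset _ (dihedral_inj fI)) card_prod card_ord card_bool.
  exact: mulnC.
apply: eq_card => g; rewrite -topredE /= [RHS]unfold_in /=; symmetry.
apply/imsetP/andP => [[u _ ->]|[gF /eqP E]].
  by rewrite dihedral_walk // dihedral_subgraph.
by have [u ->] := same_subgraph_dihedral fF gF E; exists u.
Qed.

End CyclicWalks.

(** * Counting tuples one coordinate at a time *)

Section CoordinateCount.
Variables (I T : finType).
Implicit Types (p : {ffun I -> T}) (c : I) (x : T).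

Definition update p c x : {ffun I -> T} := [ffun i => if i == c then x else p i].

(* Exchanging the coordinate [p c] with a free variable [x] is an involution of
   the pairs [(p, x)]. *)
Lemma card_coordinate c (A : pred {ffun I -> T}) (S : {ffun I -> T} -> {set T})
    (s : nat) :
  (forall p x, A (update p c x) = A p) ->
  (forall p x, S (update p c x) = S p) ->
  (forall p, A p -> #|S p| = s) ->
  #|[set p | A p & p c \in S p]| * #|T| = #|[set p | A p]| * s.
Proof.
move=> AU SU cS.
pose h (u : {ffun I -> T} * T) := (update u.1 c u.2, u.1 c).
have hK : involutive h.
  move=> [p x]; rewrite /h /=; congr pair; last by rewrite ffunE eqxx.
  by apply/ffunP=> i; rewrite !ffunE; case: eqP => // ->.
transitivity #|[set u : {ffun I -> T} * T | A u.1 & u.1 c \in S u.1]|.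
  rewrite -cardsT -cardsX; apply: eq_card => -[p x].
  by rewrite !inE andbT.
transitivity #|[set u : {ffun I -> T} * T | A u.1 & u.2 \in S u.1]|.
  rewrite -(card_imset _ (inv_inj hK)); apply: eq_card => u.
  rewrite inE; apply/imsetP/idP => [[v]|].
    by rewrite inE => hv ->; rewrite /h /= AU SU.
  move=> hu; exists (h u); last by rewrite hK.
  by rewrite inE /h /= AU SU ffunE eqxx.
rewrite -sum_nat_const (eq_bigr (fun p => #|S p|)); last first.
  by move=> p; rewrite inE => /cS.
rewrite -sum1_card (eq_bigr (fun p => \sum_(x in S p) 1)); last first.
  by move=> p _; rewrite sum1_card.
rewrite pair_big_dep /=; apply: eq_bigl => -[p x].
by rewrite !inE.
Qed.

Lemma card_coordinate_eq i c : i != c ->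
  #|[set p : {ffun I -> T} | p c == p i]| * #|T| = #|T| ^ #|I|.
Proof.
move=> ic; rewrite -card_ffun.
have := @card_coordinate c predT (fun p => [set p i]) 1.
rewrite muln1 cardsT => <- //.
- by congr (_ * _); apply: eq_card => p; rewrite !inE.
- by move=> p x; rewrite !ffunE (negPf ic).
- by move=> p _; rewrite cards1.
Qed.

Lemma card_coordinate_neq i c : i != c ->
  #|[set p : {ffun I -> T} | p i != p c]| * #|T| = #|T| ^ #|I| * #|T|.-1.
Proof.
move=> ic; rewrite -card_ffun.
have := @card_coordinate c predT (fun p => [set~ p i]) #|T|.-1.
rewrite cardsT => <- //.
- by congr (_ * _); apply: eq_card => p; rewrite !inE eq_sym.
- by move=> p x; rewrite !ffunE (negPf ic).
- by move=> p _; rewrite cardsC1.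
Qed.

End CoordinateCount.

(** * Projective planes *)

Section Plane.
Variable (Pi : projective_plane).
Local Notation P := (point Pi).
Local Notation L := (line Pi).
Implicit Types (x y z : P) (l : L).

Lemma line_unique x y l l' : x != y ->
  incident x l -> incident y l -> incident x l' -> incident y l' -> l = l'.
Proof.
move=> /join_axiom[l0 [_ U]] xl yl xl' yl'.
by rewrite -(U l) ?xl ?yl // -(U l') ?xl' ?yl'.
Qed.

Definition points_on l : {set P} := [set x | incident x l].

(** The line joining two points of the quadrangle misses at least two of its four points. *)
Lemma exists_antiflag : exists x l, ~~ incident x l.
Proof.
have [Q [cQ hQ]] := quadrangle_axiom Pi.
have /card_gt1P[x [y [xQ yQ xy]]] : 1 < #|Q| by rewrite cQ.
have [l [_ _]] := join_axiom xy.
have : ~~ (Q \subset [set p in Q | incident p l]).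
  by apply/negP => /subset_leq_card; rewrite cQ; have := hQ l; lia.
by case/subsetPn => z zQ; rewrite inE zQ /= => zl; exists z, l.
Qed.

(** The implication makes the existence total, so that [join_line] is defined on all pairs; for
    equal points it is some arbitrary line. *)
Lemma line_through x y : exists l, (x != y) ==> incident x l && incident y l.
Proof.
have [_ [l0 _]] := exists_antiflag.
by case: (altP (x =P y)) => [_|/join_axiom[l [h _]]]; [exists l0|exists l].
Qed.

Definition join_line x y : L := xchoose (line_through x y).

Lemma join_lineP x y : x != y ->
  incident x (join_line x y) /\ incident y (join_line x y).
Proof. by move=> xy; apply/andP/(implyP (xchooseP (line_through x y))). Qed.

Lemma join_line_eq x y l : x != y -> incident x l -> incident y l ->
  join_line x y = l.
Proof. by move=> xy xl yl; have [? ?] := join_lineP xy; apply: (line_unique xy). Qed.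

Variable n : nat.
Hypothesis order_n : has_order Pi n.

Lemma card_points_on l : #|points_on l| = n.+1.
Proof. exact: order_n. Qed.

(* Projecting from a point [x] off the line [l] onto [l]. *)
Lemma card_points : #|P| = n * n + n + 1.
Proof.
have [x [l xl]] := exists_antiflag.
have xneq z : incident z l -> x != z by move=> zl; apply: contraNneq xl => ->.
(* A point [y] other than [x] is reached through the point [z] where the line xy meets [l]. There
   are n + 1 choices of [z] and n points besides [x] on each line xz. *)
have E : [set~ x] =
   [set u.2 | u in [set u : P * P | (u.1 \in points_on l) &&
       (u.2 \in points_on (join_line x u.1) :\ x)]].
  apply/setP => y; rewrite !inE; apply/idP/imsetP => [yx|[[z w]]]; last first.
    by rewrite !inE /= => /andP[_ /andP[? _]] ->.
  have xy : x != y by rewrite eq_sym.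
  have [xj yj] := join_lineP xy.
  have /meet_axiom[z [/andP[zj zl] _]] : join_line x y != l.
    by apply: contraNneq xl => <-.
  exists (z, y) => //; rewrite !inE /= zl yx /=.
  by rewrite (join_line_eq (xneq _ zl) xj zj).
have : #|P|.-1 = n.+1 * n.
  rewrite -(cardsC1 x) E card_in_imset.
    rewrite -(card_points_on l) -sum_nat_const.
    rewrite (eq_bigr (fun z => #|points_on (join_line x z) :\ x|)); last first.
      move=> z; rewrite inE => zl; have [xj _] := join_lineP (xneq _ zl).
      have := cardsD1 x (points_on (join_line x z)).
      by rewrite card_points_on inE xj add1n => -[].
    rewrite (eq_bigr (fun z => \sum_(y in points_on (join_line x z) :\ x) 1)).
      rewrite pair_big_dep /= sum1_card; apply: eq_card => -[z y].
      by rewrite -[RHS]topredE /= !inE.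
    by move=> z _; rewrite sum1_card.
  (* If [y] came from two points of [l], the lines xz and xz' would coincide, hence equal [l], which
     misses [x]. *)
  move=> [z y] [z' y']; rewrite !inE /= => /and3P[zl yx yj] /and3P[zl' _ yj'] yy.
  subst y'; congr pair.
  have [xj zj] := join_lineP (xneq _ zl); have [xj' zj'] := join_lineP (xneq _ zl').
  have jj := line_unique yx yj xj yj' xj'.
  case: (altP (z =P z')) => // zz.
  have jl := line_unique zz zj _ zl zl'.
  by move: xl; rewrite -jl ?xj // jj.
have: 0 < #|P| by apply/card_gt0P; exists x.
by lia.
Qed.

End Plane.

(** * Cycles of the Levi graph as polygons *)

Section Polygons.
Variables (Pi : projective_plane) (k' : nat).
Local Notation P := (point Pi).
Local Notation L := (line Pi).
Local Notation K := 'I_k'.+4.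
(** Chosen so that m + 3 = 2k with k = k' + 4: [M] indexes the walks of length 2k and [K] the
    vertices of a k-gon. *)
Local Notation m := (k' + k' + 5).
Local Notation M := 'I_m.+3.
Local Open Scope ring_scope.
Implicit Types (i : M) (j : K).

Definition side (p : {ffun K -> P}) (j : K) : L := join_line (p j) (p (j + 1)).

Definition polygons : {set {ffun K -> P}} :=
  [set p : {ffun K -> P} | injectiveb p && injectiveb (side p)].

Lemma polygonsP (p : {ffun K -> P}) :
  reflect (injective p /\ injective (side p)) (p \in polygons).
Proof. by rewrite inE; apply: (iffP andP) => -[] /injectiveP ? /injectiveP. Qed.

(** Positions 2j and 2j + 1 of a walk will hold the point j and the side j of a polygon. The halved
    and doubled values are always in range, so [inord] never falls back on its default. *)
Definition half_ord (i : M) : K := inord i./2.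
Definition double_ord (j : K) : M := inord j.*2.

Lemma val_half i : half_ord i = i./2 :> nat.
Proof. by rewrite inordK //; have := ltn_ord i; lia. Qed.

Lemma val_double j : double_ord j = j.*2 :> nat.
Proof. by rewrite inordK //; have := ltn_ord j; lia. Qed.

Lemma ordS_val (q : nat) (i : 'I_q.+3) :
  (i + 1 : 'I_q.+3) = (if (i.+1 < q.+3)%N then i.+1 else 0%N) :> nat.
Proof.
by case h : (i.+1 < q.+3)%N; [rewrite ordS_lt|rewrite ordS_last].
Qed.

Lemma odd_ordS i : odd ((i + 1)%R : M) = ~~ odd i.
Proof. by rewrite ordS_val; have := ltn_ord i; case: ifP; lia. Qed.

Lemma half_ordS_even i : ~~ odd i -> half_ord (i + 1) = half_ord i.
Proof.
move=> oi; apply: ord_inj; rewrite !val_half ordS_val.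
by have := ltn_ord i; case: ifP; lia.
Qed.

(** At the last position 2k - 1 both sides wrap around to 0. *)
Lemma half_ordS_odd i : odd i -> half_ord (i + 1) = half_ord i + 1.
Proof.
move=> oi; apply: ord_inj; rewrite [LHS]val_half [RHS](@ordS_val k'.+1) val_half ordS_val.
by have := ltn_ord i; do 2![case: ifP]; lia.
Qed.

Lemma odd_double_ord j : odd (double_ord j) = false.
Proof. by rewrite val_double odd_double. Qed.

Lemma double_ordK : cancel double_ord half_ord.
Proof. by move=> j; apply: ord_inj; rewrite val_half val_double doubleK. Qed.

Lemma half_ordK_even i : ~~ odd i -> double_ord (half_ord i) = i.
Proof. by move=> oi; apply: ord_inj; rewrite val_double val_half; lia. Qed.

Lemma half_ordK_odd i : odd i -> double_ord (half_ord i) + 1 = i.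
Proof.
move=> oi; apply: ord_inj; rewrite [LHS]ordS_val val_double val_half.
by have := ltn_ord i; case: ifP; lia.
Qed.

Lemma double_ordS j : double_ord j + 1 + 1 = double_ord (j + 1).
Proof.
apply: ord_inj; rewrite [LHS]ordS_val [RHS]val_double !ordS_val val_double.
by have := ltn_ord j; do ![case: ifP]; lia.
Qed.

Definition polygon_walk (p : {ffun K -> P}) : {ffun M -> levi_vertex Pi} :=
  [ffun i : M => if odd i then inr (side p (half_ord i)) else inl (p (half_ord i))].

Definition is_point (v : levi_vertex Pi) := if v is inl _ then true else false.

Definition walks_from_point : {set {ffun M -> levi_vertex Pi}} :=
  [set f in cyclic_walks (@levi Pi) m | is_point (f 0)].

Lemma K_neq_succ (j : K) : j != j + 1.
Proof. by rewrite -val_eqE [X in _ != X](@ordS_val k'.+1) /=; case: ifP; lia. Qed.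

Lemma side_incident (p : {ffun K -> P}) j : injective p ->
  incident (p j) (side p j) /\ incident (p (j + 1)) (side p j).
Proof. by move=> pI; apply: join_lineP; rewrite (inj_eq pI) K_neq_succ. Qed.

Lemma polygon_walk_in p : p \in polygons -> polygon_walk p \in walks_from_point.
Proof.
move=> /polygonsP[pI sI]; rewrite inE ffunE /= andbT.
apply/cyclic_walksP; split=> [i j|i]; rewrite !ffunE.
  case: ifP => oi; case: ifP => oj // [].
    by move=> /sI E; rewrite -(half_ordK_odd oi) E half_ordK_odd.
  by move=> /pI E; rewrite -(half_ordK_even (negbT oi)) E half_ordK_even ?oj.
rewrite odd_ordS; case: (boolP (odd i)) => oi /=.
  by rewrite half_ordS_odd //; case: (side_incident (half_ord i) pI).
by rewrite half_ordS_even //; case: (side_incident (half_ord i) pI).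
Qed.

Lemma polygon_walk_inj : injective polygon_walk.
Proof.
move=> p q E; apply/ffunP => j.
have : polygon_walk p (double_ord j) = polygon_walk q (double_ord j) by rewrite E.
by rewrite !ffunE odd_double_ord double_ordK => -[].
Qed.

Lemma levi_is_point u v : levi u v -> is_point v = ~~ is_point u.
Proof. by case: u v => [?|?] [?|?]. Qed.

(** Bipartiteness puts points at even and lines at odd positions. The line at position 2j + 1
    contains the distinct points at 2j and 2j + 2, so it is their join, the side j. *)
Lemma walk_from_point_polygon f :
  f \in walks_from_point -> exists2 p, p \in polygons & f = polygon_walk p.
Proof.
rewrite inE => /andP[/cyclic_walksP[fI fe] f0].
have fP (i : M) : is_point (f i) = ~~ odd i.
  rewrite -[i in LHS](natr_Zp (i : 'Z_m.+3)).
  have: (i < m.+3)%N by [].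
  elim: (nat_of_ord i) => [|d IH] hd; first by rewrite f0.
  by rewrite -natr1 (levi_is_point (fe _)) IH //=; lia.
have /fin_all_exists[p pE] (j : K) : exists x, f (double_ord j) = inl x.
  by have := fP (double_ord j); rewrite odd_double_ord; case: (f _) => [x|] //; exists x.
have /fin_all_exists[q qE] (j : K) : exists l, f (double_ord j + 1) = inr l.
  have := fP (double_ord j + 1); rewrite odd_ordS odd_double_ord.
  by case: (f _) => [|l] //; exists l.
have pI : injective p.
  move=> i j E; apply: (can_inj double_ordK); apply: fI; by rewrite !pE E.
have qI : injective q.
  move=> i j E; apply: (can_inj double_ordK); apply: (@addIr _ 1); apply: fI.
  by rewrite !qE E.
have sE j : side [ffun j => p j] j = q j.
  rewrite /side !ffunE; apply: join_line_eq.
  - by rewrite (inj_eq pI) K_neq_succ.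
  - by have := fe (double_ord j); rewrite pE qE.
  - by have := fe (double_ord j + 1); rewrite double_ordS pE qE.
exists [ffun j => p j].
  apply/polygonsP; split=> i j; first by rewrite !ffunE => /pI.
  by rewrite !sE => /qI.
apply/ffunP => i; rewrite !ffunE; case: (boolP (odd i)) => oi.
  by rewrite sE -qE half_ordK_odd.
by rewrite -pE half_ordK_even.
Qed.

Lemma card_walks_from_point : #|walks_from_point| = #|polygons|.
Proof.
rewrite -(card_imset _ polygon_walk_inj); apply: eq_card => f.
apply/idP/imsetP => [/walk_from_point_polygon[p ? ->]|[p pG ->]]; first by exists p.
exact: polygon_walk_in.
Qed.

Definition shift_walk (f : {ffun M -> levi_vertex Pi}) :
  {ffun M -> levi_vertex Pi} := [ffun i => f (i + 1)].

Lemma shift_walk_inj : injective shift_walk.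
Proof.
move=> f g E; apply/ffunP => i.
have : shift_walk f (i - 1) = shift_walk g (i - 1) by rewrite E.
by rewrite !ffunE subrK.
Qed.

Lemma shift_walk_in f :
  f \in cyclic_walks (@levi Pi) m -> shift_walk f \in cyclic_walks (@levi Pi) m.
Proof.
move=> /cyclic_walksP[fI fe]; apply/cyclic_walksP; split=> [i j|i]; rewrite !ffunE //.
by move=> /fI/addIr.
Qed.

Lemma shift_walk_from f : f \in cyclic_walks (@levi Pi) m ->
  is_point (shift_walk f 0) = ~~ is_point (f 0).
Proof. by move=> /cyclic_walksP[_ fe]; rewrite ffunE (levi_is_point (fe 0)). Qed.

(** Shifting by one position is injective and exchanges the walks starting at a point with those
    starting at a line, so the two classes have equal size. *)
Lemma card_levi_walks : #|cyclic_walks (@levi Pi) m| = (2 * #|polygons|)%N.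
Proof.
rewrite -card_walks_from_point mul2n -addnn.
set W := cyclic_walks _ _.
rewrite -(cardsID [set f : {ffun M -> levi_vertex Pi} | is_point (f 0)] W).
have -> : W :&: [set f : {ffun M -> levi_vertex Pi} | is_point (f 0)] = walks_from_point.
  by apply/setP => f; rewrite !inE.
have wE g : (g \in walks_from_point) = (g \in W) && is_point (g 0) by rewrite in_set.
have dE g : (g \in W :\: [set f : {ffun M -> levi_vertex Pi} | is_point (f 0)]) =
    ~~ is_point (g 0) && (g \in W).
  by rewrite in_setD; congr (~~ _ && _); rewrite in_set.
have shift_le (A B : {set {ffun M -> levi_vertex Pi}}) :
    (forall f, f \in A -> shift_walk f \in B) -> (#|A| <= #|B|)%N.
  move=> AB; rewrite -(card_imset _ shift_walk_inj).
  by apply/subset_leq_card/subsetP => g /imsetP[f /AB ? ->].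
congr (_ + _)%N; apply/eqP; rewrite eqn_leq.
by apply/andP; split; apply: shift_le => f; rewrite wE dE => /andP[h1 h2];
  rewrite shift_walk_in // shift_walk_from ?h1 ?h2.
Qed.

(** Cyclic walks are counted twice, by traced subgraph and by kind of initial vertex; a factor 2
    cancels. *)
Lemma card_polygons : (num_cycles (@levi Pi) (2 * k'.+4) * (2 * k'.+4) = #|polygons|)%N.
Proof.
have -> : (2 * k'.+4 = m.+3)%N by lia.
have := card_cyclic_walks m (@levi_sym Pi); rewrite card_levi_walks.
by lia.
Qed.

End Polygons.

(** * Collinearity among the vertices of a tuple *)

Lemma card_bigcup_le (T U : finType) (F : U -> {set T}) :
  #|\bigcup_u F u| <= \sum_u #|F u|.
Proof.
elim/big_rec2: _ => [|u s A _ IH]; first by rewrite cards0.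
by apply: leq_trans (leq_card_setU _ _) _; rewrite leq_add2l.
Qed.

Lemma card_exists_le (T U : finType) (Q : U -> pred T) :
  #|[set x | [exists u, Q u x]]| <= \sum_u #|[set x | Q u x]|.
Proof.
apply: leq_trans (card_bigcup_le _); apply/subset_leq_card/subsetP => x.
by rewrite inE => /existsP[u h]; apply/bigcupP; exists u => //; rewrite inE.
Qed.

Section CollinearCounts.
Variables (Pi : projective_plane) (n : nat) (I : finType).
Hypothesis order_n : has_order Pi n.
Local Notation P := (point Pi).
Implicit Types (p : {ffun I -> P}) (S : {set I}).

(** The condition on [p c] keeps a proportion (n+1)/N of the tuples. The count is exact even where
    [p a] equals [p b], because the arbitrary [join_line] also has n + 1 points. *)
Lemma card_collinear (A : pred {ffun I -> P}) (a b c : I) :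
  (forall p x, A (update p c x) = A p) -> a != c -> b != c ->
  #|[set p | A p & p c \in points_on (join_line (p a) (p b))]| * #|P| =
  #|[set p | A p]| * n.+1.
Proof.
move=> AU ac bc.
apply: (@card_coordinate _ _ c A (fun p => points_on (join_line (p a) (p b)))) => //.
  by move=> p x; rewrite !ffunE (negPf ac) (negPf bc).
by move=> p _; rewrite (card_points_on order_n).
Qed.

Definition collinear_on S p := [exists l, [forall i in S, incident (p i) l]].

Definition doubly_collinear S S' p :=
  [&& #|S| == 3, #|S'| == 3, S != S', injectiveb p,
      collinear_on S p & collinear_on S' p].

Lemma collinear_on_join S p (a b c : I) : injective p -> collinear_on S p ->
  a \in S -> b \in S -> c \in S -> a != b ->
  p c \in points_on (join_line (p a) (p b)).
Proof.
move=> pI /existsP[l /forallP h] aS bS cS ab.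
have {}h i : i \in S -> incident (p i) l by move=> iS; have := h i; rewrite iS.
by rewrite inE (@join_line_eq _ (p a) (p b) l) ?(inj_eq pI) ?h.
Qed.

(** The vertex [c] outside [S'] is the coordinate to be constrained last: a condition on the triple
    [S'] does not involve it. *)
Lemma triple_split S S' : #|S| == 3 -> #|S'| == 3 -> S != S' ->
  exists a b c, [/\ c \notin S', a != b, a != c, b != c & S = [set a; b; c]].
Proof.
move=> /eqP c3 /eqP c3' ne.
have /subsetPn[c cS cS'] : ~~ (S \subset S').
  by apply: contra ne => h; rewrite eqEcard h c3 c3'.
have /cards2P[a [b [ab E]]] : #|S :\ c| == 2.
  by have := cardsD1 c S; rewrite cS c3 add1n => -[<-].
have [] : a \in S :\ c /\ b \in S :\ c by rewrite E !inE !eqxx orbT.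
rewrite !inE => /andP[ac aS] /andP[bc bS].
exists a, b, c; split => //.
by rewrite -(setD1K cS) E setUC.
Qed.

(** Two distinct triples give two successive conditions of proportion (n+1)/N each: first [p c'] on
    a line determined by the rest of [S'], then [p c] on a line determined by the rest of [S]. *)
Lemma card_doubly_collinear S S' :
  #|[set p | doubly_collinear S S' p]| * (#|P| * #|P|) <=
  #|P| ^ #|I| * (n.+1 * n.+1).
Proof.
have [/and3P[c3 c3' ne]|/negbTE h] := boolP [&& #|S| == 3, #|S'| == 3 & S != S'];
  last first.
  rewrite (_ : [set p | _] = set0) ?cards0 //; apply/setP => p.
  by rewrite !inE /doubly_collinear; move: h; do 3![case: (_ == _) => //=].
have [a [b [c [cS' ab ac bc ES]]]] := triple_split c3 c3' ne.
have [a' [b' [c' [cS ab' ac' bc' ES']]]] : exists a b c,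
    [/\ c \notin S, a != b, a != c, b != c & S' = [set a; b; c]].
  by apply: triple_split => //; rewrite eq_sym.
move: cS cS'; rewrite ES ES' !inE !negb_or.
move=> /andP[/andP[c'a c'b] c'c] /andP[/andP[ca' cb'] cc'].
pose A2 p := p c' \in points_on (join_line (p a') (p b')).
pose A3 p := p c \in points_on (join_line (p a) (p b)).
have C2 : #|[set p | A2 p]| * #|P| = #|P| ^ #|I| * n.+1.
  have := @card_collinear predT a' b' c' (fun _ _ => erefl) ac' bc'.
  by rewrite cardsT card_ffun => <-.
have C3 : #|[set p | A2 p & A3 p]| * #|P| = #|[set p | A2 p]| * n.+1.
  apply: card_collinear => // p x.
  by rewrite /A2 !ffunE eq_sym (negPf cc') ![_ == c]eq_sym (negPf ca') (negPf cb').
apply: (@leq_trans (#|[set p | A2 p & A3 p]| * (#|P| * #|P|))); last first.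
  by rewrite mulnA C3 mulnAC C2 mulnA.
rewrite leq_mul2r; apply/orP; right; apply/subset_leq_card/subsetP => p.
rewrite !inE => /and5P[_ _ _ /injectiveP pI /andP[cS cS']].
by apply/andP; split; [apply: (collinear_on_join pI cS')|apply: (collinear_on_join pI cS)];
   rewrite ?inE ?eqxx ?orbT.
Qed.

Definition degenerate : {set {ffun I -> P}} :=
  [set p : {ffun I -> P} | [exists u : I * I, (u.1 != u.2) && (p u.2 == p u.1)]] :|:
  [set p : {ffun I -> P} | [exists u : {set I} * {set I}, doubly_collinear u.1 u.2 p]].

(** A union bound over pairs of indices and over the 4^|I| pairs of subsets. With |I| = k the right
    side is O(n^(2k+2)), and removing N^2 leaves O(n^(2k-2)). *)
Lemma card_degenerate :
  #|degenerate| * (#|P| * #|P|) <=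
  #|I| ^ 2 * (#|P| ^ #|I| * #|P|) + 4 ^ #|I| * (#|P| ^ #|I| * (n.+1 * n.+1)).
Proof.
have := leq_card_setU
  [set p : {ffun I -> P} | [exists u : I * I, (u.1 != u.2) && (p u.2 == p u.1)]]
  [set p : {ffun I -> P} |
    [exists u : {set I} * {set I}, doubly_collinear u.1 u.2 p]].
rewrite -/degenerate => h.
apply: leq_trans (leq_mul h (leqnn _)) _; rewrite mulnDl; apply: leq_add.
  apply: leq_trans (leq_mul (card_exists_le _) (leqnn _)) _.
  rewrite big_distrl /= -mulnn -(card_prod I I) -[leqRHS]sum_nat_const; apply: leq_sum => -[i j] _ /=.
  have [->|ij] := eqVneq i j.
    by rewrite (_ : [set _ | _] = set0) ?cards0 //; apply/setP => p; rewrite !inE.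
  by rewrite mulnA /= card_coordinate_eq.
apply: leq_trans (leq_mul (card_exists_le _) (leqnn _)) _.
rewrite big_distrl /= (_ : 4 ^ #|I| = #|{: {set I} * {set I}}|).
  by rewrite -[leqRHS]sum_nat_const; apply: leq_sum => -[S S'] _; apply: card_doubly_collinear.
have cS : #|{: {set I}}| = 2 ^ #|I| by have := card_powerset [set: I]; rewrite powersetT !cardsT.
by rewrite card_prod !cS -expnMn.
Qed.

Lemma notin_degenerate p : p \notin degenerate ->
  injective p /\ forall S S', #|S| == 3 -> #|S'| == 3 ->
    collinear_on S p -> collinear_on S' p -> S = S'.
Proof.
rewrite !inE negb_or => /andP[/existsPn h1 /existsPn h2].
have pI : injective p.
  move=> i j E; apply/eqP; apply: contraT => ij.
  by have := h1 (i, j); rewrite /= ij E eqxx.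
split=> // S S' c3 c3' cS cS'; apply/eqP; apply: contraT => ne.
have := h2 (S, S'); rewrite /doubly_collinear /= c3 c3' ne cS cS' /= andbT.
by move/injectiveP: pI => ->.
Qed.

End CollinearCounts.

(** * Polygons, flat consecutive triples and inclusion bounds *)

Section PolygonCount.
Variables (Pi : projective_plane) (n : nat) (k' : nat).
Hypothesis order_n : has_order Pi n.
Local Notation P := (point Pi).
Local Notation K := 'I_k'.+4.
Local Notation E := (degenerate Pi K).
Implicit Types (p : {ffun K -> P}) (i j : K).
Local Open Scope ring_scope.

Definition consecutive i : {set K} := [set i; i + 1; i + 1 + 1].

(** The third point may coincide with either of the first two, so that the cardinality is exactly
    N^(k-2) (N-1) (n+1); such coincidences are absorbed by the degenerate tuples. *)
Definition flat_at i : {set {ffun K -> P}} :=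
  [set p : {ffun K -> P} | (p i != p (i + 1)) && (p (i + 1 + 1) \in points_on (side p i))].

(** Here k >= 4 enters: 1, 2 and 3 are nonzero modulo k. *)
Lemma K_nat_neq0 (d : nat) : (0 < d < 4)%N -> (d%:R : K) != 0.
Proof. by move=> ?; apply: (@Zp_small_neq0 k'.+1); lia. Qed.

Lemma K_add_neq (d : nat) i j : (0 < d < 4)%N -> j = i + d%:R -> i != j.
Proof.
move=> /K_nat_neq0 d0 ->; apply: contra d0 => /eqP E0.
by rewrite -(addKr i d%:R) -E0 addNr.
Qed.

Lemma card_consecutive i : #|consecutive i| == 3%N.
Proof.
rewrite /consecutive setUC cardsU1 cards2 !inE.
have -> : i != i + 1 by apply: (@K_add_neq 1).
rewrite ![i + 1 + 1 == _]eq_sym (negPf (@K_add_neq 1 (i + 1) _ _ _)) //.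
by rewrite (negPf (@K_add_neq 2 i _ _ _)) //; ring.
Qed.

(** If i differs from j but lies in the triple of j, then i is j + 1 or j + 2, and the triple of i
    contains j + 3, which the triple of j does not. *)
Lemma consecutive_inj : injective consecutive.
Proof.
move=> i j Eij; apply/eqP; apply: contraT => ij.
have n3 : j + 1 + 1 + 1 \notin consecutive j.
  rewrite !inE ![j + 1 + 1 + 1 == _]eq_sym !negb_or.
  by apply/andP; split; [apply/andP; split|];
    [apply: (@K_add_neq 3)|apply: (@K_add_neq 2)|apply: (@K_add_neq 1)] => //; ring.
have : i \in consecutive j by rewrite -Eij !inE eqxx.
rewrite !inE (negPf ij) /= => /orP[] /eqP Ei; case/negP: n3; rewrite -Eij Ei !inE eqxx ?orbT //.
Qed.

Lemma flat_collinear i p :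
  injective p -> p \in flat_at i -> collinear_on (consecutive i) p.
Proof.
move=> pI; rewrite inE => /andP[_ h].
have [h1 h2] := side_incident i pI.
apply/existsP; exists (side p i); apply/forallP => j; apply/implyP.
by rewrite !inE => /orP[/orP[]|] /eqP -> //; rewrite inE in h.
Qed.

(** For distinct points, flatness at [i] makes the sides [i] and [i + 1] coincide. *)
Lemma flat_not_polygon i p : p \in flat_at i -> p \notin polygons Pi k'.
Proof.
rewrite inE => /andP[_ h]; apply/negP => /polygonsP[pI sI].
have [h1 h2] := side_incident i pI.
have : side p (i + 1) = side p i.
  by apply: join_line_eq; rewrite ?(inj_eq pI) ?K_neq_succ //; rewrite inE in h.
by move/sI/eqP; rewrite eq_sym; apply/negP/K_neq_succ.
Qed.

(** Two sides coincide. If they are adjacent, three consecutive points are collinear. *)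
Lemma polygon_or_flat p : p \notin E -> p \notin polygons Pi k' ->
  exists i, p \in flat_at i.
Proof.
move=> /notin_degenerate[pI pU]; rewrite inE.
have -> /= : injectiveb p by apply/injectiveP.
move=> /injectivePn[i [j ij sE]].
have flatI l i0 : incident (p i0) l -> incident (p (i0 + 1)) l ->
    incident (p (i0 + 1 + 1)) l -> p \in flat_at i0.
  move=> a b c; rewrite !inE (inj_eq pI) K_neq_succ /=.
  by rewrite /side (@join_line_eq _ _ _ l) // (inj_eq pI) K_neq_succ.
have [i1 i2] := side_incident i pI; have [] := side_incident j pI.
rewrite -sE => j1 j2.
have [Ej|j_i1] := eqVneq j (i + 1).
  by exists i; apply: (flatI (side p i)) => //; rewrite -Ej.
have [Ei|i_j1] := eqVneq i (j + 1).
  by exists j; apply: (flatI (side p i)) => //; rewrite -Ei.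
have c i0 : i0 != i -> i0 != i + 1 -> #|[set i0; i; i + 1]| == 3%N.
  move=> a b; rewrite -setUA cardsU1 cards2 !inE negb_or a b.
  by rewrite K_neq_succ.
have l i0 : incident (p i0) (side p i) -> collinear_on [set i0; i; i + 1] p.
  move=> a; apply/existsP; exists (side p i); apply/forallP => j0; apply/implyP.
  by rewrite !inE => /orP[/orP[]|] /eqP ->.
(* For non-adjacent equal sides, two different triples lie on the common line, against
   nondegeneracy. *)
have := pU [set j; i; i + 1] [set j + 1; i; i + 1].
have j_i : j != i by rewrite eq_sym.
have j1_i1 : j + 1 != i + 1 by apply: contra j_i => /eqP/addIr ->.
rewrite !c ?l // 1?eq_sym // => /(_ isT isT isT isT)/setP/(_ j).
by rewrite !inE eqxx (negPf (K_neq_succ j)) (negPf j_i) (negPf j_i1).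
Qed.

Lemma card_flat i :
  (#|flat_at i| * (#|P| * #|P|) = #|P| ^ k'.+4 * #|P|.-1 * n.+1)%N.
Proof.
have h (d : nat) j0 j1 := @K_add_neq d j0 j1.
have n2 : i != i + 1 + 1 by apply: (h 2) => //; ring.
have C1 := @card_coordinate_neq K P i (i + 1) (K_neq_succ i).
have := @card_collinear Pi n K order_n (fun p => p i != p (i + 1)) i (i + 1) (i + 1 + 1).
rewrite -/(flat_at i) mulnA => -> //; last exact: K_neq_succ.
  by rewrite mulnAC C1 card_ord.
by move=> p x; rewrite !ffunE (negPf n2) (negPf (K_neq_succ (i + 1))).
Qed.

Lemma polygons_lower :
  (#|P| ^ k'.+4 <= #|polygons Pi k'| + \sum_i #|flat_at i| + #|E|)%N.
Proof.
have h : setT \subset polygons Pi k' :|: \bigcup_i flat_at i :|: E.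
  apply/subsetP => p _; rewrite in_setU in_setU.
  have [_|/polygon_or_flat hE] := boolP (p \in E); first by rewrite orbT.
  have [//|/hE[i hi]] := boolP (p \in polygons Pi k').
  by rewrite orbF /=; apply/bigcupP; exists i.
have := subset_leq_card h; rewrite cardsT card_ffun card_ord => /leq_trans; apply.
apply: leq_trans (leq_card_setU _ _) _; rewrite leq_add2r.
by apply: leq_trans (leq_card_setU _ _) _; rewrite leq_add2l card_bigcup_le.
Qed.

(** Each tuple is weighed on both sides. A nondegenerate one counts at most once on the left, since
    a polygon is nowhere flat and two flat indices would give two collinear triples; a degenerate
    one counts at most 1 + k times. *)
Lemma polygons_upper :
  (#|polygons Pi k'| + \sum_i #|flat_at i| <= #|P| ^ k'.+4 + k'.+4 * #|E|)%N.
Proof.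
have cE (A : {set {ffun K -> P}}) : #|A| = \sum_p (p \in A : nat) :> nat.
  by rewrite -sum1_card big_mkcond.
have -> : (#|P| ^ k'.+4 = \sum_(p : {ffun K -> P}) 1)%N.
  by rewrite sum1_card card_ffun card_ord.
rewrite !cE (eq_bigr _ (fun i _ => cE (flat_at i))) exchange_big /= big_distrr /=.
rewrite -!big_split /=; apply: leq_sum => p _.
have [pE|pE] := boolP (p \in E).
  apply: leq_add; first exact: leq_b1.
  rewrite muln1 -[X in (_ <= X)%N]card_ord -sum1_card; apply: leq_sum => i _.
  exact: leq_b1.
rewrite muln0 addn0.
have [pI pU] := notin_degenerate pE.
have [/existsP[i hi]|/existsPn h] := boolP [exists i, p \in flat_at i].
  rewrite (negPf (flat_not_polygon hi)) (bigD1 i) //= hi big1 // => j ji.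
  case: (boolP (p \in flat_at j)) => // hj; case/eqP: ji; apply: consecutive_inj.
  by apply: pU; rewrite ?card_consecutive // flat_collinear.
by rewrite big1 ?addn0 ?leq_b1 // => i _; rewrite (negPf (h i)).
Qed.

End PolygonCount.

(** * Asymptotics *)

(** The expansion N^(i+1) = n^(2i+2) + (i+1) n^(2i+1) + O(n^(2i)), with n^(2i) factored out. *)
Lemma expn_plane_order (i : nat) : exists C, forall n, 0 < n ->
  n ^ (2 * i) * (n * n + i.+1 * n) <= (n * n + n + 1) ^ i.+1 <=
  n ^ (2 * i) * (n * n + i.+1 * n + C).
Proof.
elim: i => [|i [C IH]]; first by exists 1 => n _; rewrite expn1 mul1n; lia.
(* The sum of the coefficients of n^2, n and 1 in (n^2 + n + 1)(n^2 + (i+1) n + C). *)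
exists (3 * C + 2 * i + 3) => n n0; have /andP[lo hi] := IH n n0.
have -> : n ^ (2 * i.+1) = n ^ (2 * i) * (n * n) by rewrite mulnSr expnD.
move: lo hi; set a := n ^ (2 * i); rewrite [_ ^ i.+2]expnS; set X := _ ^ i.+1 => lo hi.
rewrite -!mulnA; apply/andP; split.
  apply: (leq_trans _ (leq_mul (leqnn _) lo)); rewrite [leqRHS]mulnCA leq_mul2l; nia.
apply: (leq_trans (leq_mul (leqnn _) hi) _); rewrite [leqLHS]mulnCA leq_mul2l.
apply/orP; right.
have [r ->] : exists r, n = r + 1 by exists n.-1; lia.
nia.
Qed.

Lemma quadratic_le_square n c d : 0 < n ->
  n * n + c * n + d <= n * n * (1 + c + d).
Proof.
move=> n0; rewrite !mulnDr muln1 -!addnA !leq_add2l; apply: leq_add.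
  by rewrite mulnC leq_mul2r leq_pmulr ?orbT.
by apply: leq_pmull; rewrite muln_gt0 n0.
Qed.

Lemma flat_factor_bounds n : 0 < n ->
  n * n * n <= (n * n + n) * n.+1 <= n * n * n + 3 * (n * n).
Proof.
move=> n0.
have -> : (n * n + n) * n.+1 = n * n * n + 2 * (n * n) + n by ring.
have h : n <= n * n by apply: leq_pmulr.
by apply/andP; lia.
Qed.

(** The product is n^5 + O(n^4): with T = (N-1)(n+1), the bound T <= n^3 + 3n^2 serves for the
    leading term n^2 and T <= 4n^3 for the others. *)
Lemma flat_product_le n c d : 0 < n ->
  (n * n + c * n + d) * ((n * n + n) * n.+1) <=
  (n + (4 * (c + d) + 3)) * (n * n * (n * n)).
Proof.
move=> n0; have /andP[_] := flat_factor_bounds n0; set T := _ * n.+1 => hT.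
have h1 : n * n * T <= n * n * (n * n * n + 3 * (n * n)) by rewrite leq_mul2l hT orbT.
have h2 : T <= 4 * (n * n * n).
  apply: leq_trans hT _; have : n * n <= n * n * n by apply: leq_pmulr.
  by lia.
have h3 : c * n * T <= c * n * (4 * (n * n * n)) by rewrite leq_mul2l h2 orbT.
have h4 : d * T <= d * n * (4 * (n * n * n)).
  by apply: leq_mul => //; apply: leq_pmulr.
rewrite !mulnDl; apply: leq_trans (leq_add (leq_add h1 h3) h4) _.
by apply: eq_leq; ring.
Qed.

Lemma polygon_count_asymptotic (k' : nat) : exists C, forall n (Pi : projective_plane),
  0 < n -> has_order Pi n ->
  #|polygons Pi k'| <= n ^ (2 * k'.+4) + C * n ^ (2 * k'.+4 - 2) /\
  n ^ (2 * k'.+4) <= #|polygons Pi k'| + C * n ^ (2 * k'.+4 - 2).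
Proof.
(* [C1] belongs to N^(k-2), which governs flat and degenerate tuples, and [C2] to N^k. *)
have [C1 H1] := expn_plane_order k'.+1; have [C2 H2] := expn_plane_order k'.+3.
pose k := k'.+4.
pose C3 := 4 * (k'.+2 + C1) + 3.
pose Y := 1 + k'.+2 + C1.
pose C4 := k ^ 2 * (3 * Y) + 4 ^ k * (4 * Y).
(* [C2] is the error of N^k, [C3] that of one flat count, and [C4] bounds the degenerate tuples,
   which enter once in the lower bound and k times in the upper one. *)
exists (C2 + k * C4 + k * C3 + C4) => n Pi n0 order_n.
have cP := card_points order_n; set N := n * n + n + 1 in cP.
have N0 : 0 < N by rewrite /N; lia.
pose a := n ^ (2 * k'.+1).
have Ea : n ^ (2 * k'.+4 - 2) = a * (n * n * (n * n)).
  by rewrite /a !mulnn -expnM -expnD; congr (_ ^ _); lia.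
have Eb : n ^ (2 * k'.+4) = a * (n * n * (n * n)) * (n * n).
  by rewrite -Ea mulnn -expnD; congr (_ ^ _); lia.
rewrite Ea Eb.
have /andP[lo1 hi1] := H1 n n0; have /andP[lo2 hi2] := H2 n n0.
rewrite -/N -/a in lo1 hi1 lo2 hi2.
have E2 : n ^ (2 * k'.+3) = a * (n * n * (n * n)).
  by rewrite -Ea; congr (_ ^ _); lia.
rewrite E2 in lo2 hi2.
set A := a * (n * n * (n * n)) in lo2 hi2 *.
set X := N ^ k'.+2 in lo1 hi1.
(* Splitting off N^2 allows cancelling the factor N^2 carried by the flat and degenerate counts. *)
have XE : N ^ k'.+4 = X * (N * N) by rewrite /X mulnA -!expnSr.
have flatE (i : 'I_k'.+4) : #|flat_at Pi i| = X * (n * n + n) * n.+1.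
  have := card_flat order_n i; rewrite cP XE.
  rewrite (_ : N.-1 = n * n + n); last by rewrite /N; lia.
  move=> h; apply/eqP; rewrite -(eqn_pmul2r (_ : 0 < N * N)) ?muln_gt0 ?N0 // h.
  by apply/eqP; ring.
have lower := polygons_lower Pi k'; have upper := polygons_upper Pi k'.
have degE : #|degenerate Pi 'I_k'.+4| <= k ^ 2 * (X * N) + 4 ^ k * (X * (n.+1 * n.+1)).
  rewrite -(leq_pmul2r (_ : 0 < N * N)) ?muln_gt0 ?N0 //.
  have := card_degenerate 'I_k'.+4 order_n; rewrite cP card_ord XE => /leq_trans; apply.
  by apply: eq_leq; rewrite -/k; ring.
rewrite (eq_bigr _ (fun i _ => flatE i)) sum_nat_const card_ord cP -/k in lower upper.
move: degE lower upper lo2 hi2.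
set G := #|polygons _ _|; set D := #|degenerate _ _|; set F := k * _; set Nk := N ^ k'.+4.
move=> degE lower upper lo2 hi2.
have nn : n <= n * n by apply: leq_pmulr.
have XY : X <= a * (n * n) * Y.
  apply: leq_trans hi1 _; rewrite -mulnA leq_mul2l; apply/orP; right.
  exact: quadratic_le_square.
have DC : D <= C4 * A.
  apply: leq_trans degE _; rewrite /C4 mulnDl; apply: leq_add.
    rewrite -mulnA leq_mul2l; apply/orP; right.
    apply: (@leq_trans (a * (n * n) * Y * (3 * (n * n)))).
      by apply: leq_mul => //; rewrite /N; lia.
    by apply: eq_leq; rewrite /A; ring.
  rewrite -mulnA leq_mul2l; apply/orP; right.
  apply: (@leq_trans (a * (n * n) * Y * (4 * (n * n)))).
    apply: leq_mul => //; rewrite (_ : n.+1 * n.+1 = n * n + 2 * n + 1); last by ring.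
    by lia.
  by apply: eq_leq; rewrite /A; ring.
have Flo : k * n * A <= F.
  rewrite -mulnA leq_mul2l; apply/orP; right.
  apply: (@leq_trans (a * (n * n) * (n * n * n))).
    by apply: eq_leq; rewrite /A; ring.
  rewrite -[leqRHS]mulnA; apply: leq_mul; last by case/andP: (flat_factor_bounds n0).
  by apply: leq_trans lo1; rewrite leq_mul2l; apply/orP; right; lia.
have Fhi : F <= k * n * A + k * C3 * A.
  rewrite -!mulnA -mulnDr leq_mul2l; apply/orP; right.
  rewrite -[leqLHS]mulnA; apply: (leq_trans (leq_mul hi1 (leqnn _))).
  rewrite -mulnA (_ : n * A + C3 * A = a * ((n + C3) * (n * n * (n * n)))); last first.
    by rewrite /A; ring.
  rewrite leq_mul2l; apply/orP; right; exact: flat_product_le.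
have EA2 : A * (n * n + k'.+4 * n) = A * (n * n) + k * n * A by rewrite /k; ring.
have EA3 : A * (n * n + k'.+4 * n + C2) = A * (n * n) + k * n * A + C2 * A.
  by rewrite /k; ring.
rewrite EA2 in lo2; rewrite EA3 in hi2.
have kD : k'.+4 * D <= k * C4 * A by rewrite -mulnA leq_mul2l DC orbT.
(* The term k n A of order n^(2k-1) occurs in the bounds for both [Nk] and [F] and cancels; only
   multiples of A = n^(2k-2) remain as error. *)
rewrite !mulnDl; split; lia.
Qed.

Local Open Scope ring_scope.

Theorem theorem1 (R : realFieldType) (k : nat) (hk : (4 <= k)%N) :
  exists (C : R) (N : nat),
    forall (n : nat) (Pi : projective_plane), (N <= n)%N -> has_order Pi n ->
      `| (num_cycles (@levi Pi) (2 * k))%:R - (2 * k)%:R^-1 * n%:R ^+ (2 * k) |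
        <= C * n%:R ^+ (2 * k - 2).
Proof.
case: k hk => [|[|[|[|k']]]] // _.
have [C HC] := polygon_count_asymptotic k'.
exists C%:R, 1%N => n Pi n1 order_n.
have [] := HC n Pi n1 order_n; rewrite -card_polygons.
set c := num_cycles _ _; set K := (2 * k'.+4)%N => hi lo.
have K1 : 1 <= K%:R :> R by rewrite ler1n.
have K0 : 0 < K%:R :> R by apply: lt_le_trans K1.
have -> : c%:R - K%:R^-1 * n%:R ^+ K = K%:R^-1 * ((c * K)%:R - (n ^ K)%:R) :> R.
  by rewrite natrM natrX; field; rewrite lt0r_neq0.
rewrite normrM ger0_norm ?invr_ge0 ?(ltW K0) // mulrC ler_pdivrMr //.
(* Dividing by 2k >= 1 only shrinks the error, so the same constant serves. *)
apply: (@le_trans _ _ (C * n ^ (K - 2))%:R); last first.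
  by rewrite natrM natrX ler_peMr // mulr_ge0 ?exprn_ge0 ?ler0n.
have hiR : (c * K)%:R <= (n ^ K)%:R + (C * n ^ (K - 2))%:R :> R by rewrite -natrD ler_nat.
have loR : (n ^ K)%:R <= (c * K)%:R + (C * n ^ (K - 2))%:R :> R by rewrite -natrD ler_nat.
by rewrite ler_norml; apply/andP; split; lra.
Qed.
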